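(* For every simplifiable hyperoctahedral category of partitions $\mathcal C$, the set $F(\mathcal C)$ is a proper $S_0$-invariant subgroup of $E$. The map $\mathcal C\mapsto F(\mathcal C)$ is a bijection from the set of simplifiable hyperoctahedral categories of partitions onto the set of proper $S_0$-invariant subgroups of $E$, with inverse $H\mapsto\mathcal C_H$; i.e. $F(\mathcal C_H)=H$ and $\mathcal C_{F(\mathcal C)}=\mathcal C$. Both maps preserve inclusion, so $F$ is a lattice isomorphism.
   Context: A partition $p\in P(k,l)$ ($k,l\ge 0$) is a partition of the disjoint union of $k$ ordered upper points $1,\dots,k$ and $l$ ordered lower points $1',\dots,l'$ into nonempty disjoint subsets called blocks; $P=\bigcup_{k,l}P(k,l)$. Operations on partitions: the tensor product $p\otimes q$ (horizontal juxtaposition, $q$ placed to the right of $p$); the composition of $p\in P(k,l)$ with $q\in P(l,m)$ (stack $p$ on top of $q$, identify the lower points of $p$ with the upper points of $q$, merge blocks connected through these middle points, then erase the middle points and any block lying entirely among them), giving a partition in $P(k,m)$; the involution $p^*$ (reflection of $p$ upside down); and rotation (moving the leftmost, resp. rightmost, point of one row to the leftmost, resp. rightmost, position of the other row, keeping the blocks). A category of partitions is a subset $\mathcal C\subseteq P$ containing the pair partition $\sqcap\in P(0,2)$ (one block consisting of two lower points) and the identity partition $|\in P(1,1)$ (one block $\{1,1'\}$), and closed under these four operations. Special partitions: the four block $b_4\in P(0,4)$ (one block of four lower points); the double singleton $\uparrow\otimes\uparrow\in P(0,2)$ (two one-point blocks); the pair positioner $\rho\in P(3,3)$ with blocks $\{1,2,2',3'\}$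 and $\{3,1'\}$. A category of partitions $\mathcal C$ is hyperoctahedral if $b_4\in\mathcal C$ and $\uparrow\otimes\uparrow\notin\mathcal C$; it is simplifiable hyperoctahedral if moreover $\rho\in\mathcal C$. Let $L=\{a_1,a_2,\dots\}$, $\mathbb F_L$ the free group on $L$, $G=\mathbb Z_2^{*\infty}$ the free product of countably many copies of $\mathbb Z/2\mathbb Z$ generated by $a_1,a_2,\dots$ with $a_i^2=e$, and $\pi:\mathbb F_L\to G$ the canonical surjection. A labelling $\ell$ of a partition $p$ assigns pairwise distinct letters of $L$ to the blocks of $p$; $w(p,\ell)\in\mathbb F_L$ is the word obtained by reading the labels of the points of $p$ starting at the leftmost upper point, going through the upper row from left to right and then through the lower row from right to left. For a category $\mathcal C$, $F(\mathcal C)=\{\pi(w(p,\ell)) : p\in\mathcal C,\ \ell\text{ a labelling of }p\}$. $E\le G$ is the subgroup of elements of even length. $S_0\subseteq\mathrm{End}(G)$ is the subsemigroup generated by: (1) for every $n\in\mathbb N$ and every choice of indices $i(1),\dots,i(n)$, the endomorphism with $a_k\mapsto a_{i(k)}$ for $1\le k\le n$ and $a_k\mapsto a_k$ for $k>n$; (2) for every $k$, the conjugation $w\mapsto a_kwa_k$. A subgroup $H$ is $S_0$-invariant if $\phi(H)\subseteq H$ for all $\phi\in S_0$. For a proper $S_0$-invariant subgroup $H$ of $E$, $\mathcal C_H=\{p\in P : \pi(w(p,\ell))\in H\text{ for some labelling }\ell\text{ of }p\}$. *)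

(* Defs.v *)
From mathcomp Require Import all_boot.
Set Implicit Arguments. Unset Strict Implicit. Unset Printing Implicit Defensive.

(* Partitions.  A partition p in P(k,l) is stored as the list of block  *)
(* labels of its k+l points: first the upper points 1..k (left to      *)
(* right), then the lower points 1'..l' (left to right).  Two points   *)
(* are in the same block iff they carry the same label.  Labels are    *)
(* kept in canonical form (blocks numbered 0,1,2,... in order of first *)
(* occurrence), so that Leibniz equality = equality of partitions.     *)

Record part := Part { pk : nat; pl : nat; pblk : seq nat }.

Definition normalize (s : seq nat) : seq nat :=
  map (fun x => index x (rev (undup (rev s)))) s.

Definition valid (p : part) : bool :=
  (size (pblk p) == pk p + pl p) && (normalize (pblk p) == pblk p).

Definition mkpart (k l : nat) (s : seq nat) : part := Part k l (normalize s).

Definition upper (p : part) : seq nat := take (pk p) (pblk p).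
Definition lower (p : part) : seq nat := drop (pk p) (pblk p).

Definition tensor (p q : part) : part :=
  let sp := size (pblk p) in
  mkpart (pk p + pk q) (pl p + pl q)
    (upper p ++ map (addn sp) (upper q) ++ lower p ++ map (addn sp) (lower q)).

Definition involution (p : part) : part :=
  mkpart (pl p) (pk p) (lower p ++ upper p).

(* composition of p in P(k,l) with q in P(l,m) (p on top of q); only
   meaningful when pl p = pk q.  Points of the stacked picture:
   positions 0..k-1 upper of p, k..k+l-1 lower of p (middle),
   k+l..k+2l-1 upper of q (middle), then lower of q.  For each middle
   point t the two labels at positions k+t and k+l+t are merged. *)
Definition compose (p q : part) : part :=
  let k := pk p in let l := pl p in
  let sp := size (pblk p) in
  let L0 := pblk p ++ map (addn sp) (pblk q) in
  let merge (L : seq nat) (t : nat) :=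
    let a := nth 0 L (k + t) in let b := nth 0 L (k + l + t) in
    map (fun x => if x == b then a else x) L in
  let L := foldl merge L0 (iota 0 l) in
  mkpart k (pl q) (take k L ++ drop (k + l + l) L).

(* leftmost upper point -> leftmost lower position (needs pk p > 0) *)
Definition rotUL (p : part) : part :=
  mkpart (pk p).-1 (pl p).+1 (behead (upper p) ++ head 0 (upper p) :: lower p).
(* leftmost lower point -> leftmost upper position (needs pl p > 0) *)
Definition rotLU (p : part) : part :=
  mkpart (pk p).+1 (pl p).-1 (head 0 (lower p) :: upper p ++ behead (lower p)).
(* rightmost upper point -> rightmost lower position (needs pk p > 0) *)
Definition rotUR (p : part) : part :=
  mkpart (pk p).-1 (pl p).+1
    (take (pk p).-1 (upper p) ++ rcons (lower p) (last 0 (upper p))).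
(* rightmost lower point -> rightmost upper position (needs pl p > 0) *)
Definition rotLR (p : part) : part :=
  mkpart (pk p).+1 (pl p).-1
    (rcons (upper p) (last 0 (lower p)) ++ take (pl p).-1 (lower p)).

Definition pair_part : part := Part 0 2 [:: 0; 0].
Definition id_part : part := Part 1 1 [:: 0; 0].
Definition four_block : part := Part 0 4 [:: 0; 0; 0; 0].
Definition double_singleton : part := Part 0 2 [:: 0; 1].
Definition pair_positioner : part := Part 3 3 [:: 0; 0; 1; 1; 0; 0].

Record category (C : part -> Prop) : Prop := {
  cat_valid : forall p, C p -> valid p;
  cat_pair : C pair_part;
  cat_id : C id_part;
  cat_tensor : forall p q, C p -> C q -> C (tensor p q);
  cat_comp : forall p q, C p -> C q -> pl p = pk q -> C (compose p q);
  cat_involution : forall p, C p -> C (involution p);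
  cat_rotUL : forall p, C p -> 0 < pk p -> C (rotUL p);
  cat_rotLU : forall p, C p -> 0 < pl p -> C (rotLU p);
  cat_rotUR : forall p, C p -> 0 < pk p -> C (rotUR p);
  cat_rotLR : forall p, C p -> 0 < pl p -> C (rotLR p) }.

Definition hyperoctahedral (C : part -> Prop) : Prop :=
  category C /\ C four_block /\ ~ C double_singleton.

Definition simplifiable_hyperoctahedral (C : part -> Prop) : Prop :=
  hyperoctahedral C /\ C pair_positioner.

(* The group G = Z_2^{*oo}.  Letters a_1, a_2, ... are encoded by the  *)
(* natural numbers 0, 1, 2, ...  Elements of G are reduced words (no   *)
(* two consecutive equal letters).                                     *)

Definition reduced (w : seq nat) : bool :=
  if w is x :: t then path (fun a b => a != b) x t else true.

(* reduction of a word using a_i^2 = e; also the canonical map pi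
   F_L -> G restricted to positive words *)
Definition red (w : seq nat) : seq nat :=
  foldr (fun x acc => if acc is y :: t then (if x == y then t else x :: acc)
                      else [:: x]) [::] w.

Definition gmul (u v : seq nat) : seq nat := red (u ++ v).
Definition ginv (u : seq nat) : seq nat := rev u.

Definition subset_pred {T} (A B : T -> Prop) : Prop := forall x, A x -> B x.

Definition is_subgroup (H : seq nat -> Prop) : Prop :=
  subset_pred H (fun w => reduced w) /\ H [::] /\
  (forall u v, H u -> H v -> H (gmul u v)) /\
  (forall u, H u -> H (ginv u)).

Definition E (w : seq nat) : Prop := reduced w /\ ~~ odd (size w).

Inductive S0 : (seq nat -> seq nat) -> Prop :=
| S0_subst (n : nat) (i : nat -> nat) :
    S0 (fun w => red (map (fun k => if k < n then i k else k) w))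
| S0_conj (k : nat) : S0 (fun w => red (k :: w ++ [:: k]))
| S0_comp (phi psi : seq nat -> seq nat) :
    S0 phi -> S0 psi -> S0 (fun w => phi (psi w)).

Definition S0_invariant (H : seq nat -> Prop) : Prop :=
  forall phi, S0 phi -> forall w, H w -> H (phi w).

Definition proper_S0_subgroup_of_E (H : seq nat -> Prop) : Prop :=
  is_subgroup H /\ subset_pred H E /\ (exists w, E w /\ ~ H w) /\
  S0_invariant H.

Definition labelling (p : part) (l : nat -> nat) : Prop :=
  {in pblk p &, injective l}.

Definition word (p : part) (l : nat -> nat) : seq nat :=
  map l (upper p ++ rev (lower p)).

Definition F (C : part -> Prop) (w : seq nat) : Prop :=
  exists p l, C p /\ labelling p l /\ w = red (word p l).

Definition C_ (H : seq nat -> Prop) (p : part) : Prop :=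
  valid p /\ exists l, labelling p l /\ H (red (word p l)).

(* Main.v *)
(* A partition is determined, up to rotation, by the word of its block labels,
   so a category becomes a set of words closed under injective relabelling,
   cyclic rotation and reversal, where composition is a pushout of label sets
   along the glued row.  Composing with the pair deletes squares [xx]; the four
   block replaces [x] by [xxx] and identifies adjacent letters; the pair
   positioner moves a square past any letter.  Hence in a simplifiable
   hyperoctahedral category squares can be inserted and deleted anywhere and
   arbitrary letters can be identified, so the set of words is the preimage in
   the free monoid of an invariant subgroup of G.  Conversely the words of an
   invariant subgroup are closed under composition because the glued rows
   cancel in G. *)

Require Import Defs.
From mathcomp Require Import all_boot.

Set Implicit Arguments. Unset Strict Implicit. Unset Printing Implicit Defensive.

(** * Canonical labels *)

Lemma undup_map_inj_in (T1 T2 : eqType) (f : T1 -> T2) (s : seq T1) :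
  {in s &, injective f} -> undup (map f s) = map f (undup s).
Proof.
elim: s => //= x s IHs injf.
have injs : {in s &, injective f}.
  by move=> y z ys zs; apply: injf; rewrite inE ?ys ?zs orbT.
rewrite IHs //; have -> : (f x \in map f s) = (x \in s); last by case: ifP.
apply/mapP/idP => [[y ys fxy]|xs]; last by exists x.
by rewrite (injf x y) ?inE ?eqxx ?ys ?orbT.
Qed.

Lemma index_map_in (T1 T2 : eqType) (f : T1 -> T2) (s : seq T1) (x : T1) :
  {in x :: s &, injective f} -> index (f x) (map f s) = index x s.
Proof.
elim: s => //= y s IHs injf.
have -> : (f y == f x) = (y == x).
  apply/eqP/eqP => [|-> //]; by apply: injf; rewrite !inE eqxx ?orbT.
rewrite IHs // => a b; rewrite !inE => ha hb; apply: injf; rewrite !inE.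
  by case/orP: ha => ->; rewrite ?orbT.
by case/orP: hb => ->; rewrite ?orbT.
Qed.

Lemma index_inj_in (T : eqType) (s : seq T) : {in s &, injective (index^~ s)}.
Proof. by move=> x y xs ys e; rewrite -(nth_index x xs) e nth_index. Qed.

(** [undup] keeps last occurrences; the two reversals make it list letters by first occurrence, the
    order in which [normalize] numbers them. *)
Definition letters (s : seq nat) : seq nat := rev (undup (rev s)).

Lemma mem_letters s : letters s =i s.
Proof. by move=> x; rewrite mem_rev mem_undup mem_rev. Qed.

Lemma normalizeE s : normalize s = map (index^~ (letters s)) s.
Proof. by []. Qed.

Lemma index_letters_inj s : {in s &, injective (index^~ (letters s))}.
Proof. by move=> x y xs ys; apply: index_inj_in; rewrite mem_letters. Qed.

Lemma normalize_map f s : {in s &, injective f} ->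
  normalize (map f s) = normalize s.
Proof.
move=> injf; rewrite !normalizeE -map_comp; apply/eq_in_map => x xs /=.
have -> : letters (map f s) = map f (letters s).
  rewrite /letters -map_rev undup_map_inj_in ?map_rev // => y z.
  by rewrite !mem_rev; apply: injf.
apply: index_map_in => y z; rewrite !inE !mem_letters => hy hz; apply: injf.
  by case/predU1P: hy => [->|].
by case/predU1P: hz => [->|].
Qed.

Lemma size_normalize s : size (normalize s) = size s.
Proof. exact: size_map. Qed.

(** Lets later arguments treat the normal form as some injective relabelling, without its explicit
    numbering. *)
Lemma normalizeP s : exists2 f : nat -> nat,
  {in s &, injective f} & normalize s = map f s.
Proof. by exists (index^~ (letters s)); first exact: index_letters_inj. Qed.

Lemma normalize_idem s : normalize (normalize s) = normalize s.
Proof. by have [f injf e] := normalizeP s; rewrite {1}e normalize_map. Qed.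

(** * Partitions as split words *)

(* The partition with word [u ++ v], cut into its upper row [u] and its lower
   row, which a word reads from right to left. *)
Definition wp (u v : seq nat) : part := mkpart (size u) (size v) (u ++ rev v).

Lemma valid_wp u v : valid (wp u v).
Proof.
by rewrite /valid /= size_normalize size_cat size_rev eqxx normalize_idem eqxx.
Qed.

Lemma wp_map f u v : {in u ++ v &, injective f} ->
  wp (map f u) (map f v) = wp u v.
Proof.
move=> injf; rewrite /wp /mkpart !size_map -map_rev -map_cat normalize_map //.
by move=> x y; rewrite !mem_cat !mem_rev -!mem_cat; apply: injf.
Qed.

Lemma upper_wp u v f : normalize (u ++ rev v) = map f (u ++ rev v) ->
  upper (wp u v) = map f u.
Proof.
by move=> e; rewrite /upper /= e map_cat take_size_cat // size_map.
Qed.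

Lemma lower_wp u v f : normalize (u ++ rev v) = map f (u ++ rev v) ->
  lower (wp u v) = map f (rev v).
Proof.
by move=> e; rewrite /lower /= e map_cat drop_size_cat // size_map.
Qed.

Lemma valid_size p : valid p -> size (pblk p) = pk p + pl p.
Proof. by case/andP => /eqP. Qed.

Lemma size_upper p : valid p -> size (upper p) = pk p.
Proof. by move/valid_size=> e; rewrite /upper size_takel // e leq_addr. Qed.

Lemma size_lower p : valid p -> size (lower p) = pl p.
Proof. by move/valid_size=> e; rewrite /lower size_drop e addKn. Qed.

Lemma valid_wpE p : valid p -> p = wp (upper p) (rev (lower p)).
Proof.
move=> vp; rewrite /wp /mkpart size_rev size_upper // size_lower // revK.
rewrite cat_take_drop; case/andP: vp => _ /eqP ->; by case: p.
Qed.

(** Strips the normalising map [f] from the rows that an operation produces, so operations can be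
    computed on arbitrary labels. *)
Lemma mkpart_wp k l s u v f : size u = k -> size v = l ->
  {in u ++ rev v &, injective f} -> s = map f u ++ rev (map f v) ->
  mkpart k l s = wp u v.
Proof.
move=> <- <- injf ->; rewrite /wp /mkpart -map_rev -map_cat normalize_map //.
Qed.

Lemma eq_mem_inj (f : nat -> nat) (s t : seq nat) : s =i t ->
  {in s &, injective f} -> {in t &, injective f}.
Proof. by move=> st injf x y; rewrite -!st; apply: injf. Qed.

Lemma involution_wp u v : involution (wp u v) = wp (rev v) (rev u).
Proof.
have [f injf e] := normalizeP (u ++ rev v).
rewrite /involution (upper_wp e) (lower_wp e).
apply: (@mkpart_wp _ _ _ _ _ f); rewrite ?size_rev ?map_rev ?revK //.
by apply: eq_mem_inj injf => x; rewrite !mem_cat orbC.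
Qed.

(** On the word [u ++ v] a left rotation is a cyclic shift by one letter, while a right rotation
    only moves the cut. *)
Lemma rotUL_wp x u v : rotUL (wp (x :: u) v) = wp u (rcons v x).
Proof.
have [f injf e] := normalizeP ((x :: u) ++ rev v).
rewrite /rotUL (upper_wp e) (lower_wp e) /=.
apply: (@mkpart_wp _ _ _ _ _ f); rewrite ?size_rcons ?map_rcons ?rev_rcons ?map_rev //.
apply: eq_mem_inj injf => y.
rewrite /= !(mem_cat, mem_rev, inE, mem_rcons).
  by case: (y == x) (y \in u) (y \in v) => [] [] [].
Qed.

Lemma rotLU_wp x u v : rotLU (wp u (rcons v x)) = wp (x :: u) v.
Proof.
have [f injf e] := normalizeP (u ++ rev (rcons v x)).
rewrite /rotLU (upper_wp e) (lower_wp e) /= rev_rcons /=.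
apply: (@mkpart_wp _ _ _ _ _ f); rewrite ?size_rcons ?map_rev //.
apply: eq_mem_inj injf => y.
rewrite /= !(mem_cat, mem_rev, inE, mem_rcons).
  by case: (y == x) (y \in u) (y \in v) => [] [] [].
Qed.

Lemma rotUR_wp x u v : rotUR (wp (rcons u x) v) = wp u (x :: v).
Proof.
have [f injf e] := normalizeP (rcons u x ++ rev v).
rewrite /rotUR (upper_wp e) (lower_wp e) /= size_rcons map_rcons last_rcons /=.
apply: (@mkpart_wp _ _ _ _ _ f) => //.
  apply: eq_mem_inj injf => y.
  rewrite /= !(mem_cat, mem_rev, inE, mem_rcons).
  by case: (y == x) (y \in u) (y \in v) => [] [] [].
by rewrite /= rev_cons map_rev -[rcons (map f u) _]cats1 take_size_cat ?size_map.
Qed.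

Lemma rotLR_wp x u v : rotLR (wp u (x :: v)) = wp (rcons u x) v.
Proof.
have [f injf e] := normalizeP (u ++ rev (x :: v)).
rewrite /rotLR (upper_wp e) (lower_wp e) /= rev_cons map_rcons last_rcons.
apply: (@mkpart_wp _ _ _ _ _ f); rewrite ?size_rcons //.
  apply: eq_mem_inj injf => y.
  rewrite /= !(mem_cat, mem_rev, inE, mem_rcons).
  by case: (y == x) (y \in u) (y \in v) => [] [] [].
rewrite map_rcons -[rcons (map f (rev v)) _]cats1 take_size_cat ?map_rev //.
by rewrite size_rev size_map.
Qed.

(** Since lower rows are read backwards, the second word is nested inside the first. Unspecified [f]
    and [g] suffice because the words of an invariant subgroup tolerate every relabelling. *)
Lemma tensor_wp u v u' v' : exists f g,
  tensor (wp u v) (wp u' v') = wp (map f u ++ map g u') (map g v' ++ map f v).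
Proof.
have [f injf e] := normalizeP (u ++ rev v).
have [g injg e'] := normalizeP (u' ++ rev v').
set n := size (pblk (wp u v)); exists f, (addn n \o g).
rewrite /tensor (upper_wp e) (lower_wp e) (upper_wp e') (lower_wp e') /= -/n.
apply: (@mkpart_wp _ _ _ _ _ id) => //; rewrite ?size_cat ?size_map 1?addnC //.
by rewrite !map_id rev_cat -!map_comp -!map_rev !catA.
Qed.

(** * Composition as a pushout *)

Section Merge.
Variables a b : nat -> nat.

Let merge (L : seq nat) (t : nat) :=
  map (fun x => if x == nth 0 L (b t) then nth 0 L (a t) else x) L.

Definition equalizes (L : seq nat) (ts : seq nat) (f : nat -> nat) :=
  {in ts, forall t, f (nth 0 L (a t)) = f (nth 0 L (b t))}.

(** The fold computes a coequalizer. Each merge replaces a label by one that [g] already identifies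
    with it, so [g] factors through [f] with [g] itself as the factor. *)
Lemma foldl_merge (L : seq nat) ts :
  {in ts, forall t, a t < size L /\ b t < size L} ->
  exists f, [/\ foldl merge L ts = map f L, equalizes L ts f &
    forall g, equalizes L ts g -> forall x, g (f x) = g x].
Proof.
elim: ts L => [|t ts IH] L ltL /=; first by exists id; rewrite map_id.
have ltL' : {in ts, forall t, a t < size L /\ b t < size L}.
  by move=> i its; apply: ltL; rewrite inE its orbT.
have [ltat ltbt] := ltL t (mem_head _ _).
set m := fun x => if x == nth 0 L (b t) then nth 0 L (a t) else x.
have mE : merge L t = map m L by [].
have [|f [-> eqf unif]] := IH (merge L t); first by rewrite size_map.
exists (f \o m); split; first by rewrite mE -map_comp.
  move=> i; rewrite inE => /predU1P[->|its] /=.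
    by rewrite /m eqxx; case: ifP.
  by have [lta ltb] := ltL' i its; have := eqf i its; rewrite mE !(nth_map 0).
move=> g eqg x /=.
have gm y : g (m y) = g y.
  by rewrite /m; case: eqP => // ->; apply: eqg; apply: mem_head.
rewrite unif // => i its; have [lta ltb] := ltL' i its.
by rewrite mE !(nth_map 0) // !gm; apply: eqg; rewrite inE its orbT.
Qed.
End Merge.

(** [gp] and [gq] are the legs of the pushout of the two label sets along the middle row; the last
    clause is its universal property. *)
Lemma compose_wp u v v' w : size v = size v' -> exists gp gq : nat -> nat,
  [/\ map gp (rev v) = map gq v',
      compose (wp u v) (wp v' w) = wp (map gp u) (map gq w) &
      forall fp fq : nat -> nat, map fp (rev v) = map fq v' -> exists h : nat -> nat,
        {in u ++ v, forall x, fp x = h (gp x)} /\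
        {in v' ++ w, forall y, fq y = h (gq y)}].
Proof.
move=> sv; pose cp := letters (u ++ rev v); pose cq := letters (v' ++ rev w).
pose np := index^~ cp; pose nq := index^~ cq.
pose sp := size u + size v.
have memp x : x \in u ++ v -> x \in cp.
  by rewrite mem_letters !mem_cat mem_rev.
have memq x : x \in v' ++ w -> x \in cq.
  by rewrite mem_letters !mem_cat mem_rev.
(* Labels of the first partition stay below [sp], so the shifted labels of the second never collide
   with them. *)
have ltp x : x \in u ++ v -> np x < sp.
  move=> /memp xc; apply: (@leq_trans (size cp)); first by rewrite index_mem.
  rewrite /cp /letters size_rev (leq_trans (size_undup _)) // size_rev size_cat.
  by rewrite size_rev.
set L0 := map np (u ++ rev v) ++ map (addn sp) (map nq (v' ++ rev w)).
have sizeL : size L0 = size u + size v + (size v' + size w).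
  by rewrite size_cat !size_map !size_cat !size_rev.
have nthp t : t < size v -> nth 0 L0 (size u + t) = np (nth 0 (rev v) t).
  move=> lt; rewrite nth_cat size_map size_cat size_rev ltn_add2l lt.
  rewrite (nth_map 0) ?size_cat ?size_rev ?ltn_add2l // nth_cat.
  by rewrite ltnNge leq_addr /= addKn.
have nthq t : t < size v ->
    nth 0 L0 (size u + size v + t) = sp + nq (nth 0 v' t).
  move=> lt; rewrite nth_cat size_map size_cat size_rev ltnNge leq_addr /=.
  rewrite addKn -map_comp (nth_map 0) ?size_cat -?sv ?ltn_addr //=.
  by rewrite nth_cat -sv lt.
have [|f [fE eqf unif]] :=
    @foldl_merge (addn (size u)) (addn (size u + size v)) L0 (iota 0 (size v)).
  move=> t; rewrite mem_iota add0n sizeL /= => lt.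
  rewrite -sv -!addnA !ltn_add2l; split; first exact: ltn_addr.
  by rewrite ltn_addr.
exists (f \o np), (f \o (fun y => sp + nq y)); split.
- apply: (@eq_from_nth _ 0); rewrite ?size_map ?size_rev // => t lt.
  rewrite !(nth_map 0) ?size_rev -?sv //= -nthp // -nthq //.
  by apply: eqf; rewrite mem_iota.
- have -> : compose (wp u v) (wp v' w) = mkpart (size u) (size w)
      (take (size u) (map f L0) ++ drop (size u + size v + size v) (map f L0)).
    rewrite -fE /compose /= !normalizeE.
    by rewrite [size (map _ (u ++ rev v))]size_map size_cat size_rev.
  rewrite /wp /mkpart !size_map; congr (Part _ _ (normalize (_ ++ _))).
    rewrite -map_take take_cat size_map size_cat size_rev.
    (* The comparison is between [size u] and [size u + size v]; it fails only when [v] is empty. *)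
    case: ltnP => [lt|]; last first.
      rewrite -{2}[size u]addn0 leq_add2l leqn0 => /eqP sv0.
      rewrite sv0 addn0 subnn take0 cats0.
      by rewrite (size0nil sv0) cats0 -map_comp.
    by rewrite -map_take take_size_cat // -map_comp.
  rewrite -map_drop drop_cat size_map size_cat size_rev ltnNge leq_addr /=.
  by rewrite addKn -!map_drop drop_size_cat -?sv // -!map_rev -!map_comp.
- move=> fp fq efpq.
  (* On the disjoint union of both label sets, [g] decodes a normalised label and then applies [fp]
     or [fq]. *)
  pose g z := if z < sp then fp (nth 0 cp z) else fq (nth 0 cq (z - sp)).
  have gp x : x \in u ++ v -> g (np x) = fp x.
    by move=> xuv; rewrite /g ltp // nth_index ?memp.
  have gq y : y \in v' ++ w -> g (sp + nq y) = fq y.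
    by move=> yw; rewrite /g ltnNge leq_addr /= addKn nth_index ?memq.
  have eqg : equalizes (addn (size u)) (addn (size u + size v)) L0
      (iota 0 (size v)) g.
    move=> t; rewrite mem_iota add0n => /= lt.
    rewrite nthp // nthq // gp ?gq.
    - have := congr1 (nth 0 ^~ t) efpq.
      by rewrite !(nth_map 0) ?size_rev -?sv.
    - by rewrite mem_cat mem_nth -?sv.
    by rewrite mem_cat -[_ \in v]mem_rev mem_nth ?orbT ?size_rev.
  exists g; split=> x xin /=; rewrite unif //; [by rewrite gp | by rewrite gq].
Qed.

(** Pushouts are unique up to bijection: the comparison map [h] has [k] as a left inverse on the
    letters concerned, and [wp] ignores injective relabellings. A composition can thus be read off
    from any convenient pushout. *)
Lemma compose_wp_pushout u v v' w (gp gq : nat -> nat) :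
  map gp (rev v) = map gq v' ->
  (forall fp fq : nat -> nat, map fp (rev v) = map fq v' -> exists h : nat -> nat,
     {in u ++ v, forall x, fp x = h (gp x)} /\
     {in v' ++ w, forall y, fq y = h (gq y)}) ->
  compose (wp u v) (wp v' w) = wp (map gp u) (map gq w).
Proof.
move=> egpq unig.
have sv : size v = size v'.
  by have := congr1 size egpq; rewrite !size_map size_rev.
have [fp [fq [efpq -> unif]]] := compose_wp u w sv.
have [h [hp hq]] := unif _ _ egpq; have [k [kp kq]] := unig _ _ efpq.
have -> : map gp u = map h (map fp u).
  by rewrite -map_comp; apply/eq_in_map => x xu; apply: hp; rewrite mem_cat xu.
have -> : map gq w = map h (map fq w).
  by rewrite -map_comp; apply/eq_in_map => x xw; apply: hq;
     rewrite mem_cat xw orbT.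
rewrite wp_map // => x y.
have kK z : z \in map fp u ++ map fq w -> k (h z) = z.
  rewrite mem_cat => /orP[] /mapP[t tin ->].
    by rewrite -hp ?kp // mem_cat tin.
  by rewrite -hq ?kq // mem_cat tin orbT.
by move=> xin yin e; rewrite -(kK x) // e kK.
Qed.
(** * Words modulo squares of letters *)

Lemma reduced_behead x w : reduced (x :: w) -> reduced w.
Proof. by case: w => //= y w /andP[]. Qed.

Lemma reduced_red w : reduced (red w).
Proof.
elim: w => //= x w; case: (red w) => //= y t redt.
by case: eqP => [_|/eqP neq]; [apply: (@reduced_behead y) | rewrite /= neq].
Qed.

Lemma reduced_rev w : reduced (rev w) = reduced w.
Proof.
have reducedE s : reduced s = sorted (fun a b => a != b) s by case: s.
by rewrite !reducedE rev_sorted; apply: eq_sorted => a b; rewrite eq_sym.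
Qed.

Lemma red_id w : reduced w -> red w = w.
Proof.
elim: w => //= x w IHw redw; rewrite IHw; last exact: reduced_behead redw.
by case: w {IHw} redw => //= y w /andP[/negPf -> _].
Qed.

Lemma red_pair s1 x s2 : red (s1 ++ x :: x :: s2) = red (s1 ++ s2).
Proof.
rewrite /red !foldr_cat; congr foldr; rewrite -/(red _) /= -/(red s2).
have := reduced_red s2; case: (red s2) => [|y t] /=; first by rewrite eqxx.
case: eqP => [-> |_ _]; last by rewrite eqxx.
by case: t => //= z t /andP[/negPf -> _].
Qed.

Lemma red_cat_rev u s w : red (u ++ s ++ rev s ++ w) = red (u ++ w).
Proof.
elim/last_ind: s => //= s x IH; rewrite rev_rcons cat_rcons catA /= red_pair.
by rewrite -catA.
Qed.

(** [red] only deletes squares. The principle serves both for identities in G and for membership in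
    a category; the prefix [s] makes the induction on [w] go through. *)
Lemma red_invariant (P : seq nat -> Prop) :
  (forall s1 x s2, P (s1 ++ x :: x :: s2) <-> P (s1 ++ s2)) ->
  forall w s, P (s ++ red w) <-> P (s ++ w).
Proof.
move=> Ppair; elim=> //= x w IHw s.
rewrite -cat_rcons; apply: iff_trans (IHw _).
case: (red w) => [|y t]; first by rewrite cats0 cats1.
by rewrite cat_rcons; case: eqP => [->|//]; apply: iff_sym.
Qed.

Lemma red_catl u v : red (red u ++ v) = red (u ++ v).
Proof.
apply/(red_invariant (P := fun s => red (s ++ v) = red (u ++ v)) _ u [::]) => //.
by move=> s1 x s2; rewrite -!catA /= red_pair.
Qed.

Lemma red_catr u v : red (u ++ red v) = red (u ++ v).
Proof.
apply/(red_invariant (P := fun s => red s = red (u ++ v)) _ v u) => //.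
by move=> s1 x s2; rewrite red_pair.
Qed.

Lemma red_map f w : red (map f (red w)) = red (map f w).
Proof.
apply/(red_invariant (P := fun s => red (map f s) = red (map f w)) _ w [::]) => //.
by move=> s1 x s2; rewrite !map_cat /= red_pair.
Qed.

Lemma red_rev w : red (rev (red w)) = red (rev w).
Proof.
apply/(red_invariant (P := fun s => red (rev s) = red (rev w)) _ w [::]) => //.
by move=> s1 x s2; rewrite !rev_cat !rev_cons -!cats1 -!catA /= red_pair.
Qed.

Lemma cyclic_closed (P : seq nat -> Prop) :
  (forall x s, P (x :: s) -> P (rcons s x)) ->
  forall s1 s2, P (s1 ++ s2) -> P (s2 ++ s1).
Proof.
move=> Prot; elim=> [|x s1 IH] s2; first by rewrite cats0.
by move/Prot; rewrite rcons_cat => /IH; rewrite cat_rcons.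
Qed.

Lemma inverse_map f (s : seq nat) : {in s &, injective f} ->
  exists g : nat -> nat, map g (map f s) = s.
Proof.
move=> injf; exists (fun z => nth 0 s (index z (map f s))).
rewrite -map_comp -[RHS]map_id; apply/eq_in_map => x xs /=.
exact: nth_index_map.
Qed.

(** The blocks carry normalised numbers, so the labelling must undo the normalisation. *)
Lemma word_wp w : exists l,
  labelling (wp w [::]) l /\ word (wp w [::]) l = w.
Proof.
have [f injf e] := normalizeP (w ++ rev [::]).
have [|g gK] := @inverse_map f w; first by rewrite cats0 in injf.
exists g; rewrite cats0 in e.
split; last first.
  by rewrite /word (@upper_wp _ _ f) ?cats0 // (@lower_wp _ _ f) ?cats0.
rewrite /labelling /= cats0 e => _ _ /mapP[x xw ->] /mapP[y yw ->].
have gfK z : z \in w -> g (f z) = z.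
  by move: gK; rewrite -map_comp -[RHS]map_id => /eq_in_map; apply.
by rewrite !gfK // => ->.
Qed.

(** * From invariant subgroups to categories *)

Section SubgroupCategory.
Variable H : seq nat -> Prop.
Hypothesis subH : is_subgroup H.
Hypothesis invH : S0_invariant H.

Let K s := H (red s).

Lemma subgroup_word_nil : K [::].
Proof. by case: subH => _ []. Qed.

Lemma subgroup_word_cat s t : K s -> K t -> K (s ++ t).
Proof.
case: subH => _ [_ [mulH _]] Ks Kt; have := mulH _ _ Ks Kt.
by rewrite /gmul red_catl red_catr.
Qed.

Lemma subgroup_word_rev s : K s -> K (rev s).
Proof.
case: subH => redH [_ [_ invgH]] /invgH Hs.
by rewrite /K -red_rev red_id //; apply: redH Hs.
Qed.

Lemma subgroup_word_map f s : K s -> K (map f s).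
Proof.
(* A substitution in [S0] changes only letters below a bound; this bound exceeds every letter of
   [s]. *)
move=> Ks; have := invH (S0_subst (\max_(x <- s) x).+1 f) Ks.
rewrite red_map; congr (H (red _)); apply/eq_in_map => x xs.
by rewrite ltnS leq_bigmax_seq.
Qed.

Lemma subgroup_word_unmap f s : {in s &, injective f} -> K (map f s) -> K s.
Proof.
by case/inverse_map => g gK /(subgroup_word_map g); rewrite gK.
Qed.

(** Conjugating [x s] by its first letter gives [x x s x], which reduces to [s x]. *)
Lemma subgroup_word_cyclic s1 s2 : K (s1 ++ s2) -> K (s2 ++ s1).
Proof.
move: s1 s2; apply: cyclic_closed => x s /(invH (S0_conj x)).
rewrite -cat1s -red_catr red_catl red_catr -cats1.
by rewrite (red_pair [::] x (s ++ [:: x])).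
Qed.

(** One good labelling is as good as any, because the words of [H] are closed under every
    relabelling. *)
Lemma C_wp u v : C_ H (wp u v) <-> K (u ++ v).
Proof.
have [f injf e] := normalizeP (u ++ rev v).
have wordE l : word (wp u v) l = map l (map f (u ++ v)).
  by rewrite /word (upper_wp e) (lower_wp e) -map_rev revK -map_cat.
have injf' : {in u ++ v &, injective f}.
  by apply: eq_mem_inj injf => x; rewrite !mem_cat mem_rev.
split=> [[_ [l [injl]]]|Kuv].
  rewrite wordE -map_comp; apply: subgroup_word_unmap => x y xs ys /injl.
  have memf z : z \in u ++ v -> f z \in pblk (wp u v).
    by rewrite /= e => zs; apply: map_f; move: zs; rewrite !mem_cat mem_rev.
  by move=> exy; apply: injf' => //; apply: exy; apply: memf.
split; first exact: valid_wp.
exists id; split=> [? ? _ _ //|]; rewrite wordE map_id.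
exact: subgroup_word_map.
Qed.

Lemma C_wpP p : C_ H p -> exists u v, p = wp u v /\ K (u ++ v).
Proof.
move=> Cp; have vp : valid p by case: Cp.
by rewrite (valid_wpE vp) in Cp *; do 2![eexists]; split=> //; apply/C_wp.
Qed.

Lemma category_C : category (C_ H).
Proof.
split.
- by move=> p [].
- by apply/(C_wp [::] [:: 0; 0]); apply: subgroup_word_nil.
- by apply/(C_wp [:: 0] [:: 0]); apply: subgroup_word_nil.
- move=> _ _ /C_wpP[u [v [-> Kp]]] /C_wpP[u' [v' [-> Kq]]].
  have [f [g ->]] := tensor_wp u v u' v'; apply/C_wp.
  (* Moving [map f v] to the front yields a rotation of the first word followed by the second
     word. *)
  rewrite catA; apply: subgroup_word_cyclic; rewrite !catA -catA -!map_cat.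
  apply: subgroup_word_cat; apply: subgroup_word_map => //.
  exact: subgroup_word_cyclic.
- move=> _ _ /C_wpP[u [v [-> Kp]]] /C_wpP[v' [w [-> Kq]]] /= sv.
  have [gp [gq [egpq -> _]]] := compose_wp u w sv; apply/C_wp.
  (* In the product of the two relabelled words the middle rows are mutually inverse and cancel. *)
  have := subgroup_word_cat (subgroup_word_map gp Kp) (subgroup_word_map gq Kq).
  by rewrite /K !map_cat -egpq -!catA map_rev red_cat_rev.
- move=> _ /C_wpP[u [v [-> Kp]]]; rewrite involution_wp; apply/C_wp.
  by rewrite -rev_cat; apply: subgroup_word_rev.
- move=> _ /C_wpP[[|x u] [v [-> Kp]]] //= _; rewrite rotUL_wp; apply/C_wp.
  by rewrite -cats1 catA; apply: (@subgroup_word_cyclic [:: x]).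
- move=> _ /C_wpP[u [v [-> Kp]]]; case/lastP: v => // v x in Kp * => _.
  rewrite rotLU_wp; apply/C_wp; move: Kp; rewrite -cats1 catA.
  exact: subgroup_word_cyclic.
- move=> _ /C_wpP[u [v [-> Kp]]]; case/lastP: u => // u x in Kp * => _.
  by rewrite rotUR_wp; apply/C_wp; rewrite -cat_rcons.
- move=> _ /C_wpP[u [[|x v] [-> Kp]]] //= _; rewrite rotLR_wp; apply/C_wp.
  by rewrite cat_rcons.
Qed.

Lemma F_C w : F (C_ H) w <-> H w.
Proof.
split=> [[p [l [Cp [injl ->]]]]|Hw].
  have vp : valid p by case: Cp.
  apply: subgroup_word_map.
  by rewrite (valid_wpE vp) in Cp; move/C_wp: Cp.
have rw : reduced w by case: subH => redH _; apply: redH.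
have [l [injl wE]] := word_wp w; exists (wp w [::]), l; rewrite wE red_id //.
by split=> //; apply/C_wp; rewrite /K cats0 red_id.
Qed.

Lemma C_simplifiable : (exists w, E w /\ ~ H w) ->
  simplifiable_hyperoctahedral (C_ H).
Proof.
move=> [w [[rw ew] nHw]]; split; last first.
  (* The word 001001 of the pair positioner reduces to the empty word. *)
  by apply/(C_wp [:: 0; 0; 1] [:: 0; 0; 1]); apply: subgroup_word_nil.
split; first exact: category_C.
split; first by apply/(C_wp [::] [:: 0; 0; 0; 0]); apply: subgroup_word_nil.
(* Relabelling the double singleton gives all words of two letters, and these generate all of [E],
   against properness. *)
move/(C_wp [::] [:: 1; 0]) => K10; apply: nHw; rewrite -(red_id rw) -/(K w).
have [n] := ubnP (size w); elim: n w ew {rw} => // n IH [|x [|y w]] //= ew lt.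
  by move=> *; apply: subgroup_word_nil.
apply: (@subgroup_word_cat [:: x; y] w).
  exact: (subgroup_word_map (fun z => if z is 0 then y else x) K10).
by apply: IH; [rewrite negbK in ew | apply: ltnW].
Qed.

End SubgroupCategory.

(** * From categories to invariant subgroups *)

Definition ident (x y z : nat) : nat := if z == y then x else z.

Section CategoryWords.
Variable C : part -> Prop.
Hypothesis catC : category C.

Definition cat_word (s : seq nat) : Prop := C (wp s [::]).
Local Notation D := cat_word.

(** Right rotations move the cut one letter at a time without changing the word. *)
Lemma cat_wordP u v : C (wp u v) <-> D (u ++ v).
Proof.
elim: v u => [|x v IH] u; first by rewrite cats0.
rewrite -cat_rcons; apply: iff_trans (IH _); split=> Cp.
  by rewrite -rotLR_wp; apply: cat_rotLR.
by rewrite -rotUR_wp; apply: cat_rotUR => //=; rewrite size_rcons.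
Qed.

Lemma cat_word_cyclic s1 s2 : D (s1 ++ s2) -> D (s2 ++ s1).
Proof.
move: s1 s2; apply: cyclic_closed => x s Dxs; rewrite -cats1.
apply/(cat_wordP s [:: x]).
by rewrite -[wp s _](rotUL_wp x s [::]); apply: cat_rotUL.
Qed.

(** Brings a factor to the end of the word, where it can be glued as the lower row of a
    composition. *)
Lemma cat_word_focus s1 t s2 : D ((s2 ++ s1) ++ t) <-> D (s1 ++ t ++ s2).
Proof. by rewrite catA -catA; split; apply: cat_word_cyclic. Qed.

Lemma cat_word_inj f s : {in s &, injective f} -> D (map f s) <-> D s.
Proof. by move=> injf; rewrite /D -[[::]]/(map f [::]) wp_map ?cats0. Qed.

Lemma cat_word_rev s : D s -> D (rev s).
Proof. by move=> /(cat_involution catC); rewrite involution_wp => /(cat_wordP [::]). Qed.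

Lemma cat_word_pushout u v v' w (gp gq : nat -> nat) :
  D (u ++ v) -> D (v' ++ w) -> map gp (rev v) = map gq v' ->
  (forall fp fq : nat -> nat, map fp (rev v) = map fq v' ->
     exists h : nat -> nat,
       {in u ++ v, forall x, fp x = h (gp x)} /\
       {in v' ++ w, forall y, fq y = h (gq y)}) ->
  D (map gp u ++ map gq w).
Proof.
move=> /(cat_wordP u v) Cp /(cat_wordP v' w) Cq egpq unig.
apply/(cat_wordP (map gp u) (map gq w)).
rewrite -(compose_wp_pushout egpq unig); apply: cat_comp => //=.
by have := congr1 size egpq; rewrite !size_map size_rev.
Qed.

(** Gluing along an empty middle row: the pushout is the disjoint union. *)
Lemma cat_word_disjoint s t : D s -> D t -> {in s, forall x, x \notin t} ->
  D (s ++ t).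
Proof.
move=> Ds Dt st; rewrite -(map_id s) -(map_id t).
apply: (@cat_word_pushout s [::] [::] t) => //; first by rewrite cats0.
move=> fp fq _; exists (fun x => if x \in s then fp x else fq x).
split=> [x|x xt]; first by rewrite cats0 => ->.
by case: ifP => // /st; rewrite xt.
Qed.

(** A rewriting rule: a word [v ++ w] of the category allows the suffix [rev (map g v)] to be
    replaced by [map g w]. As [w] has no letters outside [v], the labels of the first word already
    form the pushout. *)
Lemma cat_word_subst g s v w : {subset w <= v} ->
  D (s ++ rev (map g v)) -> D (v ++ w) -> D (s ++ map g w).
Proof.
move=> wv Ds Dv; rewrite -(map_id s).
apply: (cat_word_pushout Ds Dv); first by rewrite map_id revK.
move=> fp fq; rewrite revK -map_comp => /eq_in_map efpq; exists fp; split=> // y.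
by rewrite mem_cat => /orP[|/wv] yv; rewrite -efpq.
Qed.

Lemma cat_word_del s1 x s2 : D (s1 ++ x :: x :: s2) -> D (s1 ++ s2).
Proof.
move=> Ds; apply: cat_word_cyclic.
rewrite -[_ ++ _]cats0; apply: (@cat_word_subst (fun=> x) _ [:: 0; 0] [::]) => //.
  exact/(cat_word_focus s1 [:: x; x]).
by apply/(cat_wordP [::]); apply: (cat_pair catC).
Qed.

Lemma cat_word_nil : D [::].
Proof.
by apply: (@cat_word_del [::] 0 [::]); apply/(cat_wordP [::]);
   apply: (cat_pair catC).
Qed.

(** * Consequences of the four block and the pair positioner *)

Section Simplifiable.
Hypothesis fourC : C four_block.
Hypothesis rhoC : C pair_positioner.

Lemma cat_word_move c t s1 s2 :
  D (s1 ++ [:: c; c] ++ t ++ s2) -> D (s1 ++ t ++ [:: c; c] ++ s2).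
Proof.
elim: t s1 => //= e t IH s1 Ds.
rewrite -cat_rcons; apply: IH; rewrite /= cat_rcons.
(* A rotation of the positioner's word is 100100; with 0 sent to [c] and 1 to [e] it replaces
   [c c e] by [e c c]. *)
apply/(cat_word_focus s1 [:: e; c; c]);
apply: (@cat_word_subst (nth 0 [:: c; e]) _ [:: 1; 0; 0] [:: 1; 0; 0]).
- by [].
- exact/(cat_word_focus s1 [:: c; c; e]).
by apply/(@cat_word_cyclic [:: 0; 0] [:: 1; 0; 0; 1]); apply/(cat_wordP [:: 0; 0; 1]).
Qed.

(** A fresh letter [x] comes from a disjoint pair. If [x] already occurs, the four block triples one
    occurrence and the surplus square is moved to the required place. *)
Lemma cat_word_ins s1 x s2 : D (s1 ++ s2) -> D (s1 ++ x :: x :: s2).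
Proof.
move=> Ds; suff Dx : D ((s2 ++ s1) ++ [:: x; x]).
  exact/(cat_word_focus s1 [:: x; x]).
have {Ds} : D (s2 ++ s1) by apply: cat_word_cyclic.
move: (s2 ++ s1) => s Ds; case: (boolP (x \in s)) => [xs|xs]; last first.
  apply: cat_word_disjoint => //; last first.
    by move=> y ys; rewrite !inE orbb; apply: contraNneq xs => <-.
  apply/(@cat_word_inj (fun=> x) [:: 0; 0]).
    by move=> ? ?; rewrite !inE !orbb => /eqP-> /eqP->.
  by apply/(cat_wordP [::]); apply: (cat_pair catC).
case/splitPr: xs Ds => a b Ds; rewrite -[_ ++ [:: x; x]]cats0 -!catA /=.
rewrite -cat_rcons; apply: cat_word_move; rewrite cats0 cat_rcons.
apply/(cat_word_focus a [:: x; x; x]).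
apply: (@cat_word_subst (fun=> x) _ [:: 0] [:: 0; 0; 0]).
- by move=> y; rewrite !inE !orbb.
- exact/(cat_word_focus a [:: x]).
by apply/(cat_wordP [::]).
Qed.

Lemma cat_word_red w : D (red w) <-> D w.
Proof.
apply: (red_invariant _ w [::]) => s1 x s2.
by split; [apply: cat_word_del | apply: cat_word_ins].
Qed.

(* The four block joins adjacent points; inserting pairs of letters makes any
   two blocks adjacent. *)
Lemma cat_word_ident x y s : D s -> D (map (ident x y) s).
Proof.
move=> Ds; have xE : ident x y x = x by rewrite /ident; case: ifP.
have yE : ident x y y = x by rewrite /ident eqxx.
(* Two nested squares give [s x y y x], rotated to [y x s x y]; its final [x y] is then glued to
   half of the four block. *)
have Dxy : D (([:: y; x] ++ s) ++ [:: x; y]).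
  apply/(cat_word_focus s [:: x; y] [:: y; x]).
  rewrite -[s ++ _]/(s ++ [:: x] ++ [:: y; y; x]) catA.
  apply: (@cat_word_ins (s ++ [:: x]) y [:: x]).
  by rewrite -catA /= -[s]cats0 -catA; apply: cat_word_ins; rewrite cats0.
have D4 : D ([:: 0; 0] ++ [:: 0; 0]) by apply/(cat_wordP [::]).
have := @cat_word_pushout _ _ _ _ (ident x y) (fun=> x) Dxy D4.
rewrite /= xE yE => Dm.
(* The composition has a square of [x] on either side of the identified word. *)
apply: (@cat_word_del [::] x); rewrite -[_ ++ _]cats0.
apply: (@cat_word_del _ x); apply: Dm => // fp fq [fy fx].
exists fp; split=> z; last by rewrite !inE !orbb => /eqP->.
by move=> _; rewrite /ident; case: eqP => // ->; rewrite fx fy.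
Qed.

(** Induction on the number of distinct letters: if [f] is not injective on [s], identifying two
    letters with equal image removes one letter and does not change [map f s]. *)
Lemma cat_word_map f s : D s -> D (map f s).
Proof.
have [n] := ubnP (size (undup s)); elim: n s => // n IH s; rewrite ltnS => len Ds.
have [/allP injf|] := boolP (all (fun x => all (fun y =>
    (f x == f y) ==> (x == y)) s) s).
  apply/cat_word_inj => // x y xs ys e; apply/eqP.
  by have /allP/(_ y ys) := injf x xs; rewrite e eqxx.
case/allPn => x xs /allPn[y ys]; rewrite negb_imply => /andP[/eqP fxy xy].
have fE z : f (ident x y z) = f z by rewrite /ident; case: eqP => // ->.
have -> : map f s = map f (map (ident x y) s).
  by rewrite -map_comp; apply/eq_map => z /=; rewrite fE.
apply: IH; last exact: cat_word_ident.
have ys' : y \in undup s by rewrite mem_undup.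
rewrite -(prednK (_ : 0 < size (undup s))) in len; last by case: undup ys'.
apply: leq_trans len; rewrite ltnS -(size_rem ys'); apply: uniq_leq_size.
  exact: undup_uniq.
move=> z; rewrite mem_undup mem_rem_uniq ?undup_uniq // !inE mem_undup.
case/mapP => t ts ->; rewrite /ident; case: (eqVneq t y) => [_|neq].
  by rewrite xy xs.
by rewrite neq ts.
Qed.

(** The second word is shifted to letters disjoint from the first, and a non-injective relabelling
    afterwards undoes the shift. *)
Lemma cat_word_cat s t : D s -> D t -> D (s ++ t).
Proof.
move=> Ds Dt; pose n := (\max_(x <- s) x).+1.
have lts x : x \in s -> x < n by move=> xs; rewrite ltnS leq_bigmax_seq.
have -> : s ++ t = map (fun z => if z < n then z else z - n)
    (s ++ map (addn n) t).
  rewrite map_cat -map_comp; congr (_ ++ _); rewrite -[LHS]map_id.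
    by apply/eq_in_map => x /lts ->.
  by apply/eq_map => x /=; rewrite ltnNge leq_addr /= addKn.
apply: cat_word_map; apply: cat_word_disjoint => //; first exact: cat_word_map.
by move=> x /lts ltx; apply/mapP => -[y _ xE]; rewrite xE ltnNge leq_addr in ltx.
Qed.

Lemma F_cat_word w : F C w <-> reduced w /\ D w.
Proof.
split=> [[p [l [Cp [_ ->]]]]|[rw Dw]].
  split; first exact: reduced_red.
  apply/cat_word_red; apply: cat_word_map.
  by apply/(cat_wordP (upper p)); rewrite -valid_wpE //; apply: (cat_valid catC).
have [l [injl wE]] := word_wp w.
by exists (wp w [::]), l; rewrite wE red_id.
Qed.

Lemma C_F p : C_ (F C) p <-> C p.
Proof.
have D_word : valid p -> C p <-> D (upper p ++ rev (lower p)).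
  by move=> vp; rewrite {1}(valid_wpE vp); apply: cat_wordP.
split=> [[vp [l [injl]]]|Cp].
  move=> /F_cat_word[_ /cat_word_red]; rewrite /word => Dp.
  apply/D_word => //; apply/(@cat_word_inj l) => // x y xp yp; apply: injl.
    by move: xp; rewrite mem_cat mem_rev -mem_cat cat_take_drop.
  by move: yp; rewrite mem_cat mem_rev -mem_cat cat_take_drop.
have vp := cat_valid catC Cp; split=> //; exists id; split=> [? ? _ _ //|].
apply/F_cat_word; split; first exact: reduced_red.
by apply/cat_word_red; rewrite /word map_id; apply/D_word.
Qed.

Lemma S0_cat_word phi w : S0 phi -> reduced w /\ D w ->
  reduced (phi w) /\ D (phi w).
Proof.
move=> S0phi; elim: S0phi w => [n i|k|f g _ IHf _ IHg] w.
- move=> [_ Dw]; split; first exact: reduced_red.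
  by apply/cat_word_red; apply: cat_word_map.
- move=> [_ Dw]; split; first exact: reduced_red.
  (* The conjugate [k w k] is a rotation of [w k k]. *)
  apply/cat_word_red; rewrite -cat1s; apply: cat_word_cyclic; rewrite -catA.
  by apply: cat_word_ins; rewrite cats0.
by move/IHg/IHf.
Qed.

Hypothesis not_singletons : ~ C double_singleton.

Lemma cat_word_not_singletons : ~ D [:: 0; 1].
Proof.
by move=> D01; apply: not_singletons; apply/(cat_wordP [::] [:: 1; 0]);
   apply: cat_word_cyclic [:: 0] [:: 1] _.
Qed.

(** An odd word, with all letters identified and squares deleted, leaves a single letter; two such
    with distinct labels form the excluded double singleton. *)
Lemma cat_word_even s : D s -> ~~ odd (size s).
Proof.
move=> Ds; apply/negP => odds; apply: cat_word_not_singletons.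
have Done x : D [:: x].
  have {Ds} := cat_word_map (fun=> x) Ds.
  have -> : map (fun=> x) s = nseq (size s) x by elim: (s) => //= _ t ->.
  rewrite -(odd_double_half (size s)) odds; elim: _./2 => //= n IH Dn.
  by apply: IH; apply: (@cat_word_del [::] x).
by apply: (@cat_word_disjoint [:: 0] [:: 1]) => // x; rewrite !inE => /eqP->.
Qed.

Lemma F_proper : proper_S0_subgroup_of_E (F C).
Proof.
split; [|split; [|split]].
- split; first by move=> w /F_cat_word[].
  split; first by apply/F_cat_word; split=> //; apply: cat_word_nil.
  split=> [u v /F_cat_word[_ Du] /F_cat_word[_ Dv]|u /F_cat_word[ru Du]].
    apply/F_cat_word; split; first exact: reduced_red.
    by apply/cat_word_red; apply: cat_word_cat.
  by apply/F_cat_word; split; [rewrite reduced_rev | apply: cat_word_rev].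
- by move=> w /F_cat_word[rw Dw]; split=> //; apply: cat_word_even.
- by exists [:: 0; 1]; split=> // /F_cat_word[_ /cat_word_not_singletons].
move=> phi S0phi w /F_cat_word Dw; apply/F_cat_word; exact: S0_cat_word.
Qed.

End Simplifiable.
End CategoryWords.

Theorem mainTheorem8 :
  (forall C, simplifiable_hyperoctahedral C -> proper_S0_subgroup_of_E (F C)) /\
  (forall H, proper_S0_subgroup_of_E H ->
     simplifiable_hyperoctahedral (C_ H) /\ (forall w, F (C_ H) w <-> H w)) /\
  (forall C, simplifiable_hyperoctahedral C -> forall p, C_ (F C) p <-> C p) /\
  (forall C1 C2, simplifiable_hyperoctahedral C1 -> simplifiable_hyperoctahedral C2 ->
     subset_pred C1 C2 -> subset_pred (F C1) (F C2)) /\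
  (forall H1 H2, proper_S0_subgroup_of_E H1 -> proper_S0_subgroup_of_E H2 ->
     subset_pred H1 H2 -> subset_pred (C_ H1) (C_ H2)).
Proof.
split=> [C [[catC [fourC singC]] rhoC]|]; first exact: F_proper.
split=> [H [subH [_ [properH invH]]]|].
  split; first exact: C_simplifiable.
  by move=> w; apply: F_C.
split=> [C [[catC [fourC _]] rhoC] p|]; first exact: C_F.
split=> [C1 C2 _ _ C12 w [p [l [Cp lw]]]|H1 H2 _ _ H12 p [vp [l [injl Hw]]]].
  by exists p, l; split; first exact: C12.
by split=> //; exists l; split=> //; apply: H12.
Qed.
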